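(* Let $X\subseteq[\omega]^\omega$ be a meager-unbounded set. Then the set $X\cup\mathrm{Fin}$ is productively Hurewicz.
   Context: $P(\omega)$ is the power set of $\omega$ with the topology obtained by identifying subsets of $\omega$ with their characteristic functions in the Cantor cube $2^\omega$. $[\omega]^\omega$ is the set of infinite subsets of $\omega$ and $\mathrm{Fin}$ the set of finite subsets of $\omega$; $X\cup\mathrm{Fin}$ has the subspace topology from $P(\omega)$. Each element of $[\omega]^\omega$ is identified with its increasing enumeration, so $[\omega]^\omega$ is viewed as a subset of $\omega^\omega$. For $a,b\in\omega^\omega$, $a\le^* b$ means $a(n)\le b(n)$ for all but finitely many $n$; $\mathfrak b$ is the minimal cardinality of a subset of $\omega^\omega$ that has no $\le^*$-upper bound in $\omega^\omega$. A set of reals is an infinite topological space homeomorphic to a subspace of $2^\omega$. A space $X$ is Hurewicz if for each sequence $\mathcal U_0,\mathcal U_1,\dots$ of open covers of $X$ there are finite sets $\mathcal F_n\subseteq\mathcal U_n$ such that for each $x\in X$ the set $\{n: x\in\bigcup\mathcal F_n\}$ is cofinite. A set of reals $X$ is productively Hurewicz if for each Hurewicz set of reals $Y$ the product space $X\times Y$ is Hurewicz. A nonempty set $S\subseteq[\omega]^\omega$ is a semifilter if for all $a\in S$ and $b\in[\omega]^\omega$ with $a\setminus b$ finite we have $b\in S$. It is meager if it is a meager subset of $[\omega]^\omega$. For $a,b\in[\omega]^\omega$, $a\le_S b$ means $\{n: a(n)\le b(n)\}\in S$. A set $X\subseteq[\omega]^\omega$ is meager-unbounded if $|X|\ge\mathfrak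 b$ and for each $b\in[\omega]^\omega$ there are a meager semifilter $S(b)$ and a set $A\subseteq X$ of size smaller than $\mathfrak b$ such that $b\le_{S(b)}x$ for all $x\in X\setminus A$. *)

(* Defs.v *)
From HB Require Import structures.
From mathcomp Require Import all_boot all_order all_algebra.
From mathcomp Require Import all_classical all_reals all_analysis.

Set Implicit Arguments.
Unset Strict Implicit.
Unset Printing Implicit Defensive.

Local Open Scope classical_set_scope.
Local Open Scope card_scope.

(* A subset of omega is represented by its characteristic function, so P(omega)
   is [cantor_space].  A set [A : set cantor_space] coerces to the subtype
   [set_type A], which carries the subspace topology. *)
Definition elements (a : cantor_space) : set nat := [set n | a n].

Definition InfSets : set cantor_space := [set a | infinite_set (elements a)].
Definition Fin : set cantor_space := [set a | finite_set (elements a)].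

Definition increasing_enumeration (a : cantor_space) (f : nat -> nat) : Prop :=
  (forall n, (f n < f n.+1)%N) /\ range f = elements a.

(* Meaningful only for infinite [a]; see [incr_enumP]. *)
Definition incr_enum (a : cantor_space) : nat -> nat :=
  get (increasing_enumeration a).

Lemma incr_enumP (a : cantor_space) :
  InfSets a -> increasing_enumeration a (incr_enum a).
Proof.
move=> infa; apply: getPex.
have next_ex m : exists k, (m <= k)%N && a k.
  apply: contrapT => nex; apply: infa.
  apply: (@sub_finite_set _ _ `I_m) => [k ak /=|]; last exact: finite_II.
  by rewrite ltnNge; apply/negP => mk; apply: nex; exists k; rewrite mk.
pose next m := ex_minn (next_ex m).
have nextP m : [/\ (m <= next m)%N, a (next m) &
    forall k, (m <= k)%N -> a k -> (next m <= k)%N].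
  rewrite /next; case: ex_minnP => k /andP[mk ak] kmin; split=> // l ml al.
  by apply: kmin; rewrite ml.
pose fix f n := if n is m.+1 then next (f m).+1 else next 0%N.
have f_lt n : (f n < f n.+1)%N by have [] := nextP (f n).+1.
exists f; split=> //; apply/seteqP; split=> [_ [[|n] _ <-]|k ak].
- by have [] := nextP 0%N.
- by have [] := nextP (f n).+1.
have lek n : (n <= f n)%N.
  by elim: n => // n IHn; exact: leq_ltn_trans IHn (f_lt n).
have exk : exists n, (k <= f n)%N by exists k.
case: (ex_minnP exk) => n kfn nmin; exists n => //.
apply/eqP; rewrite eqn_leq kfn andbT; case: n kfn nmin => [|n] _ nmin.
  by have [_ _ ->] := nextP 0%N.
have [_ _ -> //] := nextP (f n).+1.
by rewrite ltnNge; apply/negP => /nmin; rewrite ltnn.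
Qed.

Definition le_star (a b : nat -> nat) : Prop :=
  \forall n \near \oo, (a n <= b n)%N.

Definition unbounded (B : set (nat -> nat)) : Prop :=
  ~ exists c : nat -> nat, forall a, B a -> le_star a c.

(* [has_card_frakb B] says that B has cardinality frak b: B is an unbounded
   family of least possible cardinality.  Such families exist since cardinals
   are well-ordered, and are equinumerous. *)
Definition has_card_frakb (B : set (nat -> nat)) : Prop :=
  unbounded B /\ forall C, unbounded C -> B #<= C.

Definition card_ge_frakb {T : Type} (A : set T) : Prop :=
  exists B, has_card_frakb B /\ B #<= A.

Definition card_lt_frakb {T : Type} (A : set T) : Prop :=
  exists B, [/\ has_card_frakb B, A #<= B & ~ (B #<= A)].

Definition homeomorphic (X Y : topologicalType) : Prop :=
  exists (f : X -> Y) (g : Y -> X),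
    [/\ continuous f, continuous g, cancel f g & cancel g f].

Definition set_of_reals (X : topologicalType) : Prop :=
  infinite_set [set: X] /\ exists A : set cantor_space, homeomorphic X A.

Definition open_cover {X : topologicalType} (U : set (set X)) : Prop :=
  U `<=` open /\ cover U id = [set: X].

Definition hurewicz (X : topologicalType) : Prop :=
  forall U : nat -> set (set X), (forall n, open_cover (U n)) ->
  exists F : nat -> set (set X),
    (forall n, finite_set (F n) /\ F n `<=` U n) /\
    forall x : X, finite_set (~` [set n | cover (F n) id x]).

Definition productively_hurewicz (X : topologicalType) : Prop :=
  set_of_reals X /\
  forall Y : topologicalType,
    set_of_reals Y -> hurewicz Y -> hurewicz (X * Y)%type.

Definition nowhere_dense {T : topologicalType} (N : set T) : Prop :=
  interior (closure N) = set0.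

Definition meager {T : topologicalType} (M : set T) : Prop :=
  exists N : nat -> set T,
    (forall n, nowhere_dense (N n)) /\ M = \bigcup_n N n.

Definition semifilter (S : set cantor_space) : Prop :=
  [/\ S !=set0, S `<=` InfSets &
      forall a b, S a -> InfSets b ->
        finite_set (elements a `\` elements b) -> S b].

(* Meagerness is relative to the subspace of infinite sets. *)
Definition meager_semifilter (S : set cantor_space) : Prop :=
  semifilter S /\ meager [set a : InfSets | S (set_val a)].

Definition le_semifilter (S : set cantor_space) (a b : cantor_space) : Prop :=
  S (fun n => (incr_enum a n <= incr_enum b n)%N).

Definition meager_unbounded (X : set cantor_space) : Prop :=
  [/\ X `<=` InfSets, card_ge_frakb X &
      forall b, InfSets b ->
        exists (S A : set cantor_space),
          [/\ meager_semifilter S, A `<=` X, card_lt_frakb A &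
              forall x, (X `\` A) x -> le_semifilter S b x]].

(* Main.v *)
Require Import Defs.
From HB Require Import structures.
From mathcomp Require Import all_boot all_order all_algebra.
From mathcomp Require Import all_classical all_reals all_analysis.
From mathcomp Require Import zify.

(* For each n and m, a point (s, y) with s a subset of m and y in Y has a basic
   neighbourhood inside one member of U n; as there are only finitely many such
   s, the Hurewicz property of Y yields finite G n m inside U n and h n m such
   that, for each y and almost all n, every (x, y) with x disjoint from
   [m, h n m) is covered by G n m.  Let b grow faster than h, and compare x with
   the set enumerated by n |-> b (2n+1): if b (2n+1) <= x(n), then x has only n
   elements below b (2n+1), hence misses a block [b i, b i.+1), n <= i <= 2n.  A
   meager semifilter comes with an interval partition (p k) such that all its
   elements meet almost all intervals, so for almost all k there is such an i in
   [p k, 2 p k.+1), and finitely many members of U k suffice.  The fewer than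
   frak b exceptional x are handled by bounding the functions witnessing that
   {x} * Y is Hurewicz. *)

Set Implicit Arguments.
Unset Strict Implicit.
Unset Printing Implicit Defensive.

Local Open Scope classical_set_scope.

(** * Cylinders in the Cantor space and finite sets of numbers *)

Definition agree (m : nat) (a b : cantor_space) : Prop :=
  forall i, (i < m)%N -> a i = b i.

Lemma agree_trans m a b c : agree m a b -> agree m b c -> agree m a c.
Proof. by move=> ab bc i im; rewrite ab ?bc. Qed.

Lemma agreeW m n a b : (m <= n)%N -> agree n a b -> agree m a b.
Proof. by move=> mn ab i im; apply: ab; exact: leq_trans mn. Qed.

Lemma nbhs_agree (c : cantor_space) m : nbhs c [set a | agree m a c].
Proof.
elim: m => [|m IHm]; first by apply: filterS filterT => a _ i.
have /= pc : nbhs c (@proj nat (fun=> bool) m @^-1` [set c m]).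
  apply: (@proj_continuous nat (fun=> bool) m c).
  exact: discrete_set1.
apply: filterS (filterI IHm pc) => a [am /= acm] i.
by rewrite ltnS leq_eqVlt => /predU1P[->|/am].
Qed.

Lemma nbhs_cantorP (c : cantor_space) (O : set cantor_space) :
  nbhs c O <-> exists m, forall a, agree m a c -> O a.
Proof.
split=> [|[m mO]]; last by apply: filterS (nbhs_agree c m) => a; exact: mO.
(* The cylinders around [c] generate [F], which converges to [c] in each coordinate and hence in the
   product topology. *)
pose F := filter_from [set: nat] (fun m => [set a | agree m a c]).
have FF : Filter F.
  apply: filter_from_filter; first by exists 0%N.
  move=> i j _ _; exists (maxn i j) => // a aij.
  by split; apply: agreeW aij; rewrite ?leq_maxl ?leq_maxr.
suff Fc : F --> c by move=> /Fc[m _ mO]; exists m.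
apply/cvg_sup => i O' /= [_ [[B _ <-] /= Bc BO]].
exists i.+1 => // a ac; apply: BO; rewrite /= /proj.
by rewrite ac.
Qed.

Section Cylinders.
Context {A : set cantor_space}.

Lemma nbhs_subcantorP (x : A) (O : set A) :
  nbhs x O <-> exists m, forall z : A, agree m (set_val z) (set_val x) -> O z.
Proof.
split.
  move=> [_ [[B oB <-] /= Bx BO]].
  have /nbhs_cantorP[m mB] : nbhs (set_val x) B by exact: open_nbhs_nbhs.
  by exists m => z /mB ?; apply: BO.
move=> [m mO]; apply: (@filterS _ _ _ (set_val @^-1` [set a | agree m a (set_val x)])).
  by move=> z /mO.
apply: (@initial_continuous _ _ (set_val : A -> cantor_space)).
exact: nbhs_agree.
Qed.

Lemma open_cylinder (c : cantor_space) m :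
  open [set z : A | agree m (set_val z) c].
Proof.
rewrite openE => z zc; apply/nbhs_subcantorP; exists m => w wz.
exact: agree_trans wz zc.
Qed.

End Cylinders.

Lemma finite_set_natP (A : set nat) :
  finite_set A <-> exists N, forall n, A n -> (n < N)%N.
Proof.
split=> [/finite_seqP[s ->]|[N AN]]; last exact: sub_finite_set AN (finite_II N).
exists (\max_(i <- s) i).+1 => n /= ns; rewrite ltnS.
exact: leq_bigmax_seq.
Qed.

Lemma infinite_set_natP (A : set nat) :
  infinite_set A <-> forall N, exists2 n, (N <= n)%N & A n.
Proof.
split=> [Ainf N|Ainf /finite_set_natP[N AN]].
  apply: contrapT => nex; apply: Ainf; apply/finite_set_natP; exists N => n An.
  by rewrite ltnNge; apply/negP => Nn; apply: nex; exists n.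
by have [n Nn /AN] := Ainf N; rewrite ltnNge Nn.
Qed.

(** Binary strings of length [p] are padded with [false], so that each listed point is a finite set
    and lies in every [A] containing [Fin]. *)
Lemma agree_seq p : exists L : seq cantor_space,
  (forall s i, s \in L -> (p <= i)%N -> s i = false) /\
  forall c, exists2 s, s \in L & agree p c s.
Proof.
pose f (s : p.-tuple bool) : cantor_space := fun i => nth false s i.
exists [seq f s | s <- enum {: p.-tuple bool}]; split=> [_ i /mapP[s _ ->] pi|c].
  by rewrite /f nth_default // size_tuple.
exists (f [tuple c i | i < p]); first by rewrite map_f // mem_enum.
by move=> i ip; rewrite /f -[i]/(val (Ordinal ip)) nth_mktuple.
Qed.

(** * Nowhere dense sets and meager semifilters *)

Lemma nowhere_dense_avoid (N : set InfSets) c m : nowhere_dense N ->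
  exists d m', [/\ (m <= m')%N, agree m d c &
    forall z : InfSets, agree m' (set_val z) d -> ~ N z].
Proof.
move=> N0.
(* The padding with ones makes [e] infinite, so the cylinder of [c] has a point in [InfSets]. *)
pose e : cantor_space := fun i => if (i < m)%N then c i else true.
have Ie : InfSets e.
  apply/infinite_set_natP => n; exists (maxn n m); rewrite ?leq_maxl//.
  by rewrite /elements /= /e ltnNge leq_maxr.
have [z [zc zN]] : exists z : InfSets,
    agree m (set_val z) c /\ ~ closure N z.
  apply: contrapT => nex; suff : interior (closure N) (SigSub (mem_set Ie)).
    by rewrite N0.
  apply/nbhs_subcantorP; exists m => z zm; apply: contrapT => zN; apply: nex.
  exists z; split=> // i im; apply: etrans (zm i im) _.
  by change (e i = c i); rewrite /e im.
have [m' mm'] : exists m', forall w : InfSets,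
    agree m' (set_val w) (set_val z) -> ~ N w.
  apply/(@nbhs_subcantorP _ z (~` N)); apply: contrapT => nN; apply: zN => B Bz.
  apply: contrapT => NB; apply: nN; apply: filterS Bz => w Bw Nw.
  by apply: NB; exists w.
exists (set_val z), (maxn m m'); split=> //; first exact: leq_maxl.
by move=> w wz; apply/mm'/agreeW/wz/leq_maxr.
Qed.

(** One pattern [t] on [[p, q)] serves all pairs in [L]: a new pair only lengthens the pattern, so
    the pairs treated before remain avoided. *)
Lemma nowhere_dense_avoid_seq (N : nat -> set InfSets) p
    (L : seq (cantor_space * nat)) : (forall j, nowhere_dense (N j)) ->
  exists (t : cantor_space) q, (p < q)%N /\
    forall s j, (s, j) \in L -> forall z : InfSets, agree p (set_val z) s ->
    (forall i, (p <= i < q)%N -> set_val z i = t i) -> ~ N j z.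
Proof.
move=> N0; elim: L => [|[s j] L [t [q [pq IH]]]]; first by exists point, p.+1.
pose c : cantor_space := fun i => if (i < p)%N then s i else t i.
have [d [q' [qq' dc dN]]] := nowhere_dense_avoid c q (N0 j).
exists d, q'; split=> [|s' j']; first exact: leq_trans qq'.
rewrite inE => /predU1P[[-> ->] z zs zt|L' z zs zt].
  apply: dN => i iq'; case: (ltnP i p) => ip; last by rewrite zt ?ip.
  by rewrite zs // dc ?(ltn_trans ip) // /c ip.
apply: (IH _ _ L' z zs) => i /andP[pi iq].
by rewrite zt ?pi ?(leq_trans iq) // dc // /c ltnNge pi.
Qed.

Lemma increasing_le (p : nat -> nat) : (forall k, p k < p k.+1)%N ->
  {homo p : m n / (m <= n)%N}.
Proof.
move=> pS m n; elim: n => [|n IHn]; first by rewrite leqn0 => /eqP->.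
rewrite leq_eqVlt => /predU1P[->//|]; rewrite ltnS => /IHn /leq_trans; apply.
exact: ltnW.
Qed.

Lemma increasing_ge (p : nat -> nat) n : (forall k, p k < p k.+1)%N ->
  (n <= p n)%N.
Proof. by move=> pS; elim: n => // n IHn; exact: leq_ltn_trans IHn (pS n). Qed.

Lemma increasing_block (p : nat -> nat) k l i : (forall k, p k < p k.+1)%N ->
  (p k <= i < p k.+1)%N -> (p l <= i < p l.+1)%N -> k = l.
Proof.
move=> pS /andP[ki ik] /andP[li il]; apply/eqP; rewrite eqn_leq.
have h m n : (p m <= i)%N -> (i < p n.+1)%N -> (m <= n)%N.
  move=> mi ni; rewrite leqNgt; apply/negP => nm.
  have := increasing_le pS nm; lia.
by apply/andP; split; apply: h.
Qed.

(* Talagrand and Jalali-Naini *)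
Lemma meager_semifilter_partition S : meager_semifilter S ->
  exists p : nat -> nat, (forall k, p k < p k.+1)%N /\
    forall a, S a -> exists K, forall k, (K <= k)%N ->
      exists2 i, (p k <= i < p k.+1)%N & a i.
Proof.
move=> [[_ SI Sup] [N [N0 SN]]].
(* [f (p, k)] gives a pattern on some [[p, q)] that forces a point out of [N 0], ..., [N k],
   whatever its values below [p]; the list [L] runs through all these values. *)
have /choice[f fP] (x : nat * nat) : exists tq : cantor_space * nat,
    (x.1 < tq.2)%N /\ forall (z : InfSets) j, (j <= x.2)%N ->
    (forall i, (x.1 <= i < tq.2)%N -> set_val z i = tq.1 i) -> ~ N j z.
  have [L [_ LP]] := agree_seq x.1.
  have [t [q [pq tqP]]] := nowhere_dense_avoid_seq x.1
    [seq (s, j) | s <- L, j <- iota 0 x.2.+1] N0.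
  exists (t, q); split=> // z j jx; have [s sL zs] := LP (set_val z).
  apply: (tqP s) => //; apply/allpairsP; exists (s, j); split=> //.
  by rewrite mem_iota.
pose fix p k := if k is l.+1 then (f (p l, l)).2 else 0%N.
have pS k : (p k < p k.+1)%N by have [] := fP (p k, k).
exists p; split=> // a Sa; apply: contrapT => nex.
(* [J] collects the intervals missed by [a]. Writing the patterns there enlarges [a] to [b], which
   stays in [S]; as [J] is infinite, [b] avoids every [N j], a contradiction. *)
pose J := [set k | forall i, (p k <= i < p k.+1)%N -> ~~ a i].
have Jinf : infinite_set J.
  apply/infinite_set_natP => K; apply: contrapT => nJ; apply: nex; exists K => k Kk.
  apply: contrapT => nk; apply: nJ; exists k => // i ik.
  by apply/negP => ai; apply: nk; exists i.
pose b : cantor_space := fun i =>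
  a i || `[< exists k, [/\ J k, (p k <= i < p k.+1)%N & (f (p k, k)).1 i] >].
have Ib : InfSets b.
  have := SI _ Sa; apply: contra_not; apply: sub_finite_set => i /=.
  by rewrite /elements /= /b => ->.
have Sb : S b.
  apply: (Sup a) => //; have -> : elements a `\` elements b = set0 => //.
  by apply/seteqP; split=> // i [/= ai]; rewrite /elements /= /b ai.
pose z : InfSets := SigSub (mem_set Ib).
have : [set a : InfSets | S (set_val a)] z by [].
rewrite SN => -[j _ Nz]; move/infinite_set_natP : Jinf => /(_ j)[k jk Jk].
apply: (fP (p k, k)).2 jk _ Nz => i /= ik.
change (b i = (f (p k, k)).1 i); rewrite /b (negbTE (Jk i ik)) /=; apply/asboolP/idP => [[l [Jl il]]|fi].
  by rewrite (increasing_block pS il ik).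
by exists k.
Qed.

(** * Increasing enumerations and gaps *)

Lemma increasing_lt (p : nat -> nat) : (forall k, p k < p k.+1)%N ->
  {mono p : m n / (m < n)%N}.
Proof.
move=> pS m n; apply/idP/idP => [|mn].
  by rewrite !ltnNge; apply: contra; exact: increasing_le.
exact: leq_trans (pS m) (increasing_le pS mn).
Qed.

Lemma increasing_sub_le (f g : nat -> nat) n :
  (forall k, f k < f k.+1)%N -> (forall k, g k < g k.+1)%N ->
  range g `<=` range f -> (f n <= g n)%N.
Proof.
move=> fS gS gf; elim: n => [|n IHn].
  by have [k _ <-] := gf _ (imageT g 0%N); exact: increasing_le.
have [k _ fk] := gf _ (imageT g n.+1); rewrite -fk; apply: increasing_le => //.
by rewrite -(increasing_lt fS) fk (leq_ltn_trans IHn).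
Qed.

Lemma increasing_enumeration_unique a f g :
  increasing_enumeration a f -> increasing_enumeration a g -> f = g.
Proof.
move=> [fS fa] [gS ga]; apply/funext => n; apply/eqP; rewrite eqn_leq.
by rewrite !increasing_sub_le // fa ga.
Qed.

(* Otherwise each of the n+1 blocks [b i, b i.+1) with n <= i <= 2n contains an
   element of x, and the element of index n lies below b (2n+1). *)
Lemma incr_enum_gap x (b : nat -> nat) n : InfSets x ->
  (forall k, b k < b k.+1)%N -> (b n.*2.+1 <= incr_enum x n)%N ->
  exists2 i, (n <= i <= n.*2)%N &
    forall j, (b i <= j < b i.+1)%N -> ~~ x j.
Proof.
move=> /incr_enumP[eS ex] bS be; apply: contrapT => nex.
have full i : (n <= i <= n.*2)%N ->
    exists l, (b i <= incr_enum x l < b i.+1)%N.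
  move=> ni; apply: contrapT => nl; apply: nex; exists i => // j ij.
  apply/negP => xj; apply: nl; have : range (incr_enum x) j by rewrite ex.
  by move=> [l _ lj]; exists l; rewrite lj.
suff h j : (j <= n)%N -> (incr_enum x j < b (n + j).+1)%N.
  by have := h n (leqnn n); rewrite addnn ltnNge be.
elim: j => [|j IHj] jn.
  have [|l /andP[_ ln]] := full n; first by rewrite leqnn; lia.
  by rewrite addn0; apply: leq_ltn_trans ln; exact: increasing_le.
(* The element found in this block lies above the one of index [j], so its index is at least
   [j.+1]. *)
have [|l /andP[nl ln]] := full (n + j).+1; first by lia.
rewrite addnS; apply: leq_ltn_trans ln; apply: increasing_le => //.
by rewrite -(increasing_lt eS); apply: leq_trans (IHj (ltnW jn)) nl.
Qed.

(** * Hurewicz covers of products *)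

(** Indices in [I] can carry data that the open sets alone do not determine, and a countable [T]
    allows covers indexed by pairs of numbers. *)
Lemma hurewicz_family (Y : topologicalType) (T : countType) (I : choiceType)
    (t0 : T) (i0 : I) (D : T -> set I) (V : T -> I -> set Y) :
  hurewicz Y -> (forall t i, D t i -> open (V t i)) ->
  (forall t y, exists2 i, D t i & V t i y) ->
  exists E : T -> set I, (forall t, finite_set (E t) /\ E t `<=` D t) /\
    forall y, finite_set [set t | ~ exists2 i, E t i & V t i y].
Proof.
(* Numbers that code no element of [T] repeat the cover of [t0]. *)
move=> hY Vo Vc; pose u k := odflt t0 (unpickle k).
have uK : cancel pickle u by move=> t; rewrite /u pickleK.
have [k|F [FU Fc]] := hY (fun k => V (u k) @` D (u k)).
  split=> [_ [i Di <-]|]; first exact: Vo.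
  apply/seteqP; split=> // y _; have [i Di Vy] := Vc (u k) y.
  by exists (V (u k) i) => //; exists i.
pose r t M := xget i0 [set i | D t i /\ V t i = M].
have rP t M : F (pickle t) M -> D t (r t M) /\ V t (r t M) = M.
  move=> /(FU _).2[i Di VO]; rewrite uK in Di VO.
  by apply: (@xgetPex _ i0 [set i | D t i /\ V t i = M]); exists i.
exists (fun t => r t @` F (pickle t)); split=> [t|y].
  split=> [|_ [M FO <-]]; last exact: (rP t M FO).1.
  by apply: finite_image; exact: (FU _).1.
have := finite_preimage (in2W (can_inj uK)) (Fc y).
apply: sub_finite_set => t /= nE [M FO Oy]; apply: nE.
by have [_ VO] := rP t M FO; exists (r t M); [exists M|rewrite VO].
Qed.

(** As in the tube lemma, the neighbourhoods found for the finitely many [s] are intersected and the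
    largest [m] is kept. *)
Lemma local_cover (A : set cantor_space) (Y : topologicalType)
    (U : set (set (A * Y))) (L : seq cantor_space) (y : Y) :
  open_cover U -> (forall s, s \in L -> A s) ->
  exists (V : set Y) F m, [/\ open V, V y, finite_set F, F `<=` U &
    forall (x : A) z s, s \in L -> agree m (set_val x) s -> V z ->
      cover F id (x, z)].
Proof.
move=> [Uo Uc]; elim: L => [|s L IH] LA.
  by exists setT, set0, 0%N; split=> //; exact: openT.
have [|V [F [m [Vo Vy Ff FU VF]]]] := IH.
  by move=> s' s'L; apply: LA; rewrite inE s'L orbT.
have As : A s by apply: LA; rewrite mem_head.
pose a : A := SigSub (mem_set As).
have [M UO Oay] : cover U id (a, y) by rewrite Uc.
have [[P Q] /= [/nbhs_subcantorP[m' mP] Qy] PQO] : nbhs (a, y) M.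
  by apply: open_nbhs_nbhs; split=> //; exact: Uo.
exists (V `&` Q°), (F `|` [set M]), (maxn m m'); split.
- by apply: openI => //; exact: open_interior.
- by split.
- by rewrite finite_setU.
- by move=> Z [/FU|->].
move=> x z s'; rewrite inE => /predU1P[-> xs [Vz Qz]|s'L xs' [Vz Qz]].
  exists M; first by right.
  apply: PQO; split=> /=; last exact: interior_subset.
  by apply: mP; apply: agreeW xs; exact: leq_maxr.
have [|M' FO' M'xz] := VF x z s' s'L _ Vz; last by exists M' => //; left.
by apply: agreeW xs'; exact: leq_maxl.
Qed.

Lemma gap_cover (A : set cantor_space) (Y : topologicalType)
    (U : nat -> set (set (A * Y))) :
  Fin `<=` A -> hurewicz Y -> (forall n, open_cover (U n)) ->
  exists (h : nat -> nat -> nat) (G : nat -> nat -> set (set (A * Y))),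
    (forall n m, finite_set (G n m) /\ G n m `<=` U n) /\
    forall y, exists K, forall n, (K <= n)%N -> forall m (x : A),
      (forall i, (m <= i < h n m)%N -> ~~ set_val x i) ->
      cover (G n m) id (x, y).
Proof.
move=> FA hY Uc.
(* An index holds a neighbourhood in [Y], the end of a gap, and the finite subfamily covering the
   points with that gap. *)
pose I : Type := (set Y * (nat * set (set (A * Y))))%type.
pose D (t : nat * nat) : set I := [set e | [/\ open e.1,
  finite_set e.2.2, e.2.2 `<=` U t.1 & forall (x : A) z, e.1 z ->
    (forall i, (t.2 <= i < e.2.1)%N -> ~~ set_val x i) ->
    cover e.2.2 id (x, z)]].
(* All pairs [(n, m)] are treated together: each [y] fails for finitely many pairs only, so a single
   [K] serves all [m]. *)
have [[n m] e [] //|[n m] y|E [ED Ec]] := @hurewicz_family Y _ _ (0, 0)%N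
    (point : I) D (fun t e => e.1) hY.
  have [L [L0 LP]] := agree_seq m.
  have [s sL|V [F [m' [Vo Vy Ff FU VF]]]] := @local_cover _ _ _ L y (Uc n).
    apply: FA; apply/finite_set_natP; exists m => i; rewrite ltnNge.
    by rewrite /elements /= => si; apply/negP => /(L0 s i sL); rewrite si.
  exists (V, (m', F)) => //; split=> //= x z Vz x0.
  (* Below [m] the point [s] copies [x]; from [m] up to [m'] both vanish. *)
  have [s sL xs] := LP (set_val x); apply: (VF x z s) => // i im'.
  case: (ltnP i m) => im; first exact: xs.
  by rewrite (L0 s i sL im); apply/negbTE/x0; rewrite im.
have /choice[h hP] (n : nat) : exists f : nat -> nat, forall m e,
    E (n, m) e -> (e.2.1 < f m)%N.
  suff /choice[f fP] m : exists k, forall e, E (n, m) e -> (e.2.1 < k)%N.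
    by exists f.
  have /finite_set_natP[N NP] : finite_set ((fun e => e.2.1) @` E (n, m)).
    by apply: finite_image; exact: (ED _).1.
  by exists N => e Ee; apply: NP; exists e.
exists h, (fun n m => \bigcup_(e in E (n, m)) e.2.2); split=> [n m|y].
  have [Ef Esub] := ED (n, m); split.
    by apply: bigcup_finite => // e /Esub[].
  by move=> M [e /Esub[_ _ eU _] /eU].
have /finite_set_natP[K KP] := finite_image fst (Ec y).
exists K => n Kn m x x0.
have [e Ee ey] : exists2 e, E (n, m) e & e.1 y.
  apply: contrapT => nE; have : (n < K)%N by apply: KP; exists (n, m).
  by rewrite ltnNge Kn.
have [_ _ _ /(_ x y ey)[|M eO Oxy]] := (ED (n, m)).2 e Ee.
  move=> i /= /andP[mi ie]; apply: x0; rewrite mi.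
  exact: ltn_trans ie (hP n m e Ee).
by exists M => //; exists e.
Qed.

(** * Fewer than frak b exceptional points *)

(** Coding by bit strings makes the base countable, so a finite choice of basic sets is bounded by
    one number. *)
Definition cylinder (s : seq bool) : set cantor_space :=
  [set a | agree (size s) a (nth false s)].

Lemma agree_cylinder m c : exists2 s : seq bool, cylinder s c &
  forall a, cylinder s a -> agree m a c.
Proof.
exists [seq c i | i <- iota 0 m] => [i|a ac i im]; rewrite ?size_map ?size_iota.
  by move=> im; rewrite (nth_map 0%N) ?size_iota // nth_iota.
rewrite ac ?size_map ?size_iota // (nth_map 0%N) ?size_iota //.
by rewrite nth_iota.
Qed.

(** For fixed [x], the Hurewicz property of [Y] yields a function bounding the codes of the boxes
    needed. Fewer than frak b such functions have a common bound [c], and the [n]-th family takes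
    one member of [U n] for each usable code below [c n]. *)
Lemma small_cover (A C : set cantor_space) (Y : topologicalType)
    (U : nat -> set (set (A * Y))) :
  (exists B : set cantor_space, homeomorphic Y B) -> hurewicz Y ->
  card_lt_frakb C -> (forall n, open_cover (U n)) ->
  exists G : nat -> set (set (A * Y)),
    (forall n, finite_set (G n) /\ G n `<=` U n) /\
    forall (x : A) y, C (set_val x) ->
      exists K, forall n, (K <= n)%N -> cover (G n) id (x, y).
Proof.
move=> [B [f [g [fc gc fK gK]]]] hY [W [[_ Wmin] _ CW]] Uc.
pose box (e : seq bool * seq bool) : set (A * Y) :=
  [set z | cylinder e.1 (set_val z.1) /\ cylinder e.2 (set_val (f z.2))].
pose D n : set (seq bool * seq bool) := [set e | exists2 M, U n M & box e `<=` M].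
pose r n e := get [set M | U n M /\ box e `<=` M].
have rP n e : D n e -> U n (r n e) /\ box e `<=` r n e.
  by move=> [M UO eO]; apply: (@getPex _ [set M | U n M /\ box e `<=` M]); exists M.
have /choice[k kP] (x : A) : exists k : nat -> nat, forall y, exists K,
    forall n, (K <= n)%N ->
    exists e, [/\ D n e, (pickle e < k n)%N & box e (x, y)].
  have [n e _|n y|E [ED Ec]] := @hurewicz_family Y _ _ 0%N ([::], [::]) D
      (fun _ e => [set y | box e (x, y)]) hY.
  - case: (pselect (cylinder e.1 (set_val x))) => ex; last first.
      have -> : [set y | box e (x, y)] = set0; last exact: open0.
      by apply/seteqP; split=> // y [].
    have oe := (continuousP f).1 fc _
      (@open_cylinder B (nth false e.2) (size e.2)).
    suff -> : [set y | box e (x, y)] = f @^-1`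
        [set z : B | agree (size e.2) (set_val z) (nth false e.2)] by exact: oe.
    by apply/seteqP; split=> y // [].
  - have [M UO Oxy] : cover (U n) id (x, y) by rewrite (Uc n).2.
    have [[P Q] /= [/nbhs_subcantorP[m mP] Qy] PQO] : nbhs (x, y) M.
      by apply: open_nbhs_nbhs; split=> //; exact: (Uc n).1.
    (* Boxes are measured in [B], so [Q] is carried over to a cylinder around [f y] by continuity of
       [g]. *)
    have /gc/nbhs_subcantorP[m' mQ] : nbhs (g (f y)) Q by rewrite fK.
    have [s xs sm] := agree_cylinder m (set_val x).
    have [t yt tm] := agree_cylinder m' (set_val (f y)).
    exists (s, t) => //; exists M => // -[x' y'] [/= /sm x's /tm y't].
    apply: PQO; split=> /=; first exact: mP.
    by rewrite -(fK y'); exact: mQ.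
  have /choice[k kP] n : exists N, forall e, E n e -> (pickle e < N)%N.
    have /finite_set_natP[N NP] : finite_set (pickle @` E n).
      by apply: finite_image; exact: (ED n).1.
    by exists N => e Ee; apply: NP; exists e.
  exists k => y; have /finite_set_natP[K KP] := Ec y; exists K => n Kn.
  have [e Ee ey] : exists2 e, E n e & box e (x, y).
    by apply: contrapT => /KP; rewrite ltnNge Kn.
  by exists e; split=> //; [exact: (ED n).2|exact: kP].
(* Otherwise these functions are unbounded, so [W] injects into their set and hence into [C],
   against [CW]. *)
have [c cP] : exists c, forall a, (k @` (set_val @^-1` C)) a -> le_star a c.
  apply: contrapT => /Wmin Wk; apply: CW; apply: card_le_trans Wk _.
  apply: card_le_trans (card_image_le _ _) _; apply: card_ge_preimage.
  by apply: in2W; exact: val_inj.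
exists (fun n => r n @` [set e | D n e /\ (pickle e < c n)%N]); split=> [n|x y Cx].
  split=> [|_ [e [De _] <-]]; last exact: (rP n e De).1.
  apply: finite_image; apply: (@sub_finite_set _ _ (pickle @^-1` `I_(c n))).
    by move=> e [].
  apply: finite_preimage; last exact: finite_II.
  by apply: in2W; exact: (pcan_inj pickleK).
have [K KP] := kP x y; have [|N _ NP] := cP (k x); first by exists x.
exists (maxn K N) => n; rewrite geq_max => /andP[/KP[e [De ek ey]] /NP /= kc].
exists (r n e); last exact: (rP n e De).2.
by exists e => //; split=> //; exact: leq_trans kc.
Qed.

(** * The union of a meager-unbounded set with the finite sets *)

Lemma set_of_reals_Fin (X : set cantor_space) :
  set_of_reals (set_type (X `|` Fin)).
Proof.
split; last by exists (X `|` Fin), id, id; split=> // x; exact: cvg_id.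
pose s n : cantor_space := pred1 n.
have Fs n : (X `|` Fin) (s n).
  right; apply/finite_set_natP; exists n.+1 => i.
  by rewrite /elements /= /s /= => /eqP->.
pose f n : set_type (X `|` Fin) := SigSub (mem_set (Fs n)).
have f_inj : injective f.
  move=> m n /(congr1 set_val) mn; have : s m = s n by [].
  by move=> /(congr1 (@^~ m)); rewrite /s /= eqxx => /esym/eqP.
by move=> /(finite_preimage (in2W f_inj)); rewrite preimage_setT; exact: infinite_nat.
Qed.

Theorem corollary2p11 (X : set cantor_space) :
  meager_unbounded X -> productively_hurewicz (set_type (X `|` Fin)).
Proof.
move=> [XI _ XS]; split=> [|Y [_ YB] hY U Uc]; first exact: set_of_reals_Fin.
have [h [G [GU Gc]]] := gap_cover (@subsetUr _ X Fin) hY Uc.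
(* For [i = j.+1] the sum runs over [k <= j], which makes [b j.+1] at least [h k (b j)] for all
   these [k]. *)
pose fix b i := if i is j.+1 then ((b j).+1 + \sum_(k < i) h k (b j))%N else 0%N.
have bS i : (b i < b i.+1)%N by rewrite /= leq_addr.
have hb k i : (k <= i)%N -> (h k (b i) <= b i.+1)%N.
  rewrite -ltnS => ki; rewrite /= (bigD1 (Ordinal ki)) //=; lia.
(* This index is the one [incr_enum_gap] asks for; meager-unboundedness is applied to the range [B]
   of [c]. *)
pose c n := b n.*2.+1.
have cS n : (c n < c n.+1)%N by rewrite /c increasing_lt //; lia.
pose B : cantor_space := fun n => `[< range c n >].
have cB : range c = elements B.
  by apply/seteqP; split=> n /asboolP.
have IB : InfSets B.
  apply/infinite_set_natP => n; exists (c n); first exact: increasing_ge.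
  by rewrite -cB; exists n.
have eB : incr_enum B = c.
  by apply: (increasing_enumeration_unique (incr_enumP IB)); split.
have [S [A [/meager_semifilter_partition[p [pS Sp]] _ Asmall AS]]] := XS B IB.
have [G' [G'U G'c]] := small_cover YB hY Asmall Uc.
(* The range of [i] contains [[m, m.*2]] for each [m] in [[p n, p n.+1)], where [incr_enum_gap]
   finds its gap. *)
exists (fun n => G' n `|` \bigcup_(i < (p n.+1).*2) G n (b i)); split=> [n|].
  split; first by rewrite finite_setU; split;
    [exact: (G'U n).1|apply: bigcup_finite => // i _; exact: (GU n _).1].
  by move=> Z [/(G'U n).2//|[i _]]; exact: (GU n _).2.
move=> [x y]; apply/finite_set_natP.
suff [K KP] : exists K, forall n, (K <= n)%N -> cover (G' n) id (x, y) \/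
    exists2 i, (p n <= i < (p n.+1).*2)%N &
      forall j, (b i <= j < b i.+1)%N -> ~~ set_val x j.
  have [K' KP'] := Gc y; exists (maxn K K') => n; apply: contra_notT.
  rewrite -leqNgt geq_max => /andP[/KP[[Z GZ Zxy] _|[i /andP[pi ip] xi] Kn]].
    by exists Z => //; left.
  (* The gap reaches [h n (b i)] because [n <= p n <= i], as [hb] requires. *)
  have [|Z GZ Zxy] := KP' n Kn (b i) x.
    move=> j /andP[ij jh]; apply: xi; rewrite ij (leq_trans jh) // hb //.
    by apply: leq_trans pi; exact: increasing_ge.
  by exists Z => //; right; exists i.
have [xA|nxA] := pselect (A (set_val x)).
  by have [K KP] := G'c x y xA; exists K => n Kn; left; exact: KP.
have [Xx|Fx] : (X `|` Fin) (set_val x) by exact: set_valP.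
  have [K KP] := Sp _ (AS _ (conj Xx nxA)); exists K => n /KP[i ip].
  rewrite eB => /(incr_enum_gap (XI _ Xx) bS)[j ij xj]; right; exists j => //.
  by lia.
(* A finite [x] lies below some [K], and [b (p n) >= p n >= n], so for [n >= K] it misses the block
   of index [p n]. *)
have /finite_set_natP[K KP] := Fx; exists K => n Kn; right; exists (p n).
  by have := pS n; lia.
move=> j /andP[nj _]; apply/negP => /KP; apply/negP; rewrite -leqNgt.
by apply: leq_trans Kn (leq_trans (increasing_ge _ pS) (leq_trans (increasing_ge _ bS) nj)).
Qed.
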